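(* Let $\boldsymbol{k}=(k_1,\dots,k_r)$ be an index and $\boldsymbol{x}=(x_1,\dots,x_r)$ a tuple of indeterminates, and put $x_{r+1}\coloneqq 1$. Then for every positive integer $N$, \[ \sum_{0<n_1<\cdots<n_r<N}\frac{1}{n_1^{k_1}\cdots n_r^{k_r}}\prod_{i=1}^{r}\frac{\binom{Nx_{i+1}-1}{n_i}}{\binom{Nx_i-1}{n_i}} =(-1)^r\sum_{\substack{0< n_{j,1}\leq\cdots\leq n_{j,k_j}< N \ (1\leq j\leq r)\\ n_{j,k_j}<n_{j+1,1} \ (1\leq j<r)}}\prod_{j=1}^r\frac{1}{(n_{j,1}-Nx_j)n_{j,2}\cdots n_{j,k_j}}, \] where the sum on the right runs over integers $n_{j,l}$ ($1\le j\le r$, $1\le l\le k_j$). This is an identity of rational functions in $x_1,\dots,x_r$.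
   Context: An index is a tuple $(k_1,\dots,k_r)$ of positive integers. For an indeterminate (or number) $x$ and a non-negative integer $n$, $\binom{x}{n}\coloneqq\frac{x(x-1)\cdots(x-n+1)}{n!}$ for $n\ge1$ and $\binom{x}{0}\coloneqq1$. *)

(* Defs.v *)
From HB Require Import structures.
From mathcomp Require Import all_boot all_order all_algebra.
From mathcomp Require Import mpoly.

Set Implicit Arguments.
Unset Strict Implicit.
Unset Printing Implicit Defensive.

Import GRing.Theory.
Local Open Scope ring_scope.

Definition gbinom (F : fieldType) (x : F) (n : nat) : F :=
  (\prod_(i < n) (x - i%:R)) / (n`!)%:R.

Definition ratfun (r : nat) : fieldType := {fraction {mpoly rat[r]}}.

(* Indices are 0-based throughout: [xvar r i] is the (i+1)-st variable for
   i < r, and [xvar r r] is the extra value 1. *)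
Definition xvar (r i : nat) : ratfun r :=
  if insub i is Some j then tofrac ('X_(j : 'I_r) : {mpoly rat[r]}) else 1.

(* 0 < n_1 < ... < n_r, the upper bound < N being carried by the type. *)
Definition lhs_range (r N : nat) (n : {ffun 'I_r -> 'I_N}) : bool :=
  [forall i : 'I_r, (0 < n i)%N] &&
  [forall i : 'I_r, forall j : 'I_r, (i < j)%N ==> (n i < n j)%N].

(* Families of integers n_{j,l} < N with j < r and l < k j; n_{j,l} is [n j l]. *)
Definition family2 (r N : nat) (k : 'I_r -> nat) : finType :=
  {dffun forall j : 'I_r, {ffun 'I_(k j) -> 'I_N}}.

(* The last clause compares the last entry of each row with the first entry of
   the next row; when all k j are positive, as they are for an index, both
   entries exist. *)
Definition rhs_range (r N : nat) (k : 'I_r -> nat) (n : family2 N k) : bool :=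
  [&& [forall j : 'I_r, forall l : 'I_(k j), (0 < n j l)%N],
      [forall j : 'I_r, forall l : 'I_(k j), forall m : 'I_(k j),
         (l <= m)%N ==> (n j l <= n j m)%N]
    & [forall i : 'I_r, forall j : 'I_r, forall l : 'I_(k i), forall m : 'I_(k j),
         [&& j == i.+1 :> nat, l == (k i).-1 :> nat & m == 0%N :> nat] ==>
         (n i l < n j m)%N]].

(* Main.v *)
(** Put D_a(m, n) = C(m, n) / binom(a - 1, n).  The proof rests on
      D_a(m, n) / m = (D_a(m, n) - D_a(m - 1, n)) / n
                    = (D_a(m - 1, n - 1) - D_a(m - 1, n)) / (a - m).
    The last factor of the left-hand side is D_a(N - 1, n_r) with a = N x_r.
    The first equality, used k_r - 1 times, trades each factor 1 / n_r for a
    new summation variable b <= m with weight 1 / b; the second one then makes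
    the sum over n_r > n_(r-1) telescope to sums of D_a(b - 1, n_(r-1)) / (a - b).
    The denominator binom(a - 1, n_(r-1)) cancels against the numerator of the
    factor of index r - 1, which leaves the same sum for r - 1, with N - 1
    replaced by b - 1. *)

Require Import Defs.
From HB Require Import structures.
From mathcomp Require Import all_boot all_order all_algebra.
From mathcomp Require Import mpoly ring.

Set Implicit Arguments.
Unset Strict Implicit.
Unset Printing Implicit Defensive.

Import GRing.Theory.
Local Open Scope ring_scope.

(** * Generalized binomial coefficients *)

Lemma gbinomS (F : fieldType) (a : F) n :
  gbinom (a - 1) n.+1 = gbinom (a - 1) n * (a - n.+1%:R) / n.+1%:R.
Proof.
rewrite /gbinom big_ord_recr factS natrM invfM /= -addrA -opprD nat1r.
by rewrite [X in _ * X]mulrC mulrACA mulrA.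
Qed.

Lemma gbinom0 (F : fieldType) (a : F) : gbinom a 0 = 1.
Proof. by rewrite /gbinom big_ord0 invr1 mulr1. Qed.

(** Up to a factorial, the coefficient is the product of [a - c] over [1 <= c <= n]; characteristic
    zero keeps the factorials nonzero. *)
Lemma gbinom_neq0 (F : fieldType) (a : F) n :
  [pchar F] =i pred0 -> (forall c, (0 < c <= n)%N -> a != c%:R) ->
  gbinom (a - 1) n != 0.
Proof.
move=> /pcharf0P F0; elim: n => [|n IHn] an; first by rewrite gbinom0 oner_neq0.
have an1 : a - n.+1%:R != 0 by rewrite subr_eq0 an ?leqnn.
rewrite gbinomS mulf_neq0 ?invr_eq0 ?F0 // mulf_neq0 // IHn // => c /andP[c0 cn].
by rewrite an // c0 leqW.
Qed.

Lemma gbinom_nat (F : fieldType) m n :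
  [pchar F] =i pred0 -> (n <= m)%N -> gbinom (m%:R : F) n = 'C(m, n)%:R.
Proof.
move=> /pcharf0P F0 nm; apply: (canLR (mulfK _)).
  by rewrite F0 -lt0n fact_gt0.
rewrite -natrM bin_ffact ffact_prod natr_prod; apply: eq_bigr => i _.
by rewrite natrB // (leq_trans (ltnW (ltn_ord i))).
Qed.

(** * The connector D_a(m, n) and its two difference relations *)

Definition connector (F : fieldType) (a : F) (m n : nat) : F :=
  'C(m, n)%:R / gbinom (a - 1) n.

(** The denominators agree, so Pascal's rule leaves C(m, n - 1), and the absorption n C(m + 1, n) =
    (m + 1) C(m, n - 1) concludes. *)
Lemma connectorBl (F : fieldType) (a : F) m n : [pchar F] =i pred0 ->
  (0 < n)%N ->
  (connector a m.+1 n - connector a m n) / n%:R = connector a m.+1 n / m.+1%:R.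
Proof.
move=> /pcharf0P F0; case: n => // n _.
rewrite /connector -mulrBl mulrAC [RHS]mulrAC; congr (_ / _).
apply/eqP; rewrite eqr_div ?F0 // binS natrD addrAC subrr add0r -natrD -binS.
by rewrite mulrC -!natrM mul_bin_diag mulnC.
Qed.

(** Put X = D_a(m, n). Then D_a(m, n + 1) = X (m - n) / (a - n - 1), so the difference is X (a - m -
    1) / (a - n - 1) and the factor a - m - 1 cancels; both sides equal X / (a - n - 1). *)
Lemma connectorBr (F : fieldType) (a : F) m n : [pchar F] =i pred0 ->
  a != m.+1%:R -> (forall c, (0 < c <= n.+1)%N -> a != c%:R) ->
  (connector a m n - connector a m n.+1) / (a - m.+1%:R) =
  connector a m.+1 n.+1 / m.+1%:R.
Proof.
move=> F0 am an; have g0 : gbinom (a - 1) n != 0.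
  by apply: gbinom_neq0 => // c /andP[c0 cn]; rewrite an // c0 leqW.
have an0 : a - n.+1%:R != 0 by rewrite subr_eq0 an ?leqnn.
have am0 : a - m.+1%:R != 0 by rewrite subr_eq0.
have n0 : n.+1%:R != 0 :> F by rewrite ((pcharf0P _).1 F0).
have m0 : m.+1%:R != 0 :> F by rewrite ((pcharf0P _).1 F0).
have -> : connector a m n.+1 =
    'C(m, n)%:R * (m%:R - n%:R) / gbinom (a - 1) n / (a - n.+1%:R).
  rewrite /connector gbinomS.
  have -> : 'C(m, n.+1)%:R = 'C(m, n)%:R * (m%:R - n%:R) / n.+1%:R :> F.
    apply: (canRL (mulfK n0)); rewrite -natrM mulnC mul_bin_left.
    (* The subtraction [m - n] is truncated in [nat] but not in [F]; for [m < n] both sides vanish,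
       the field side because C(m, n) = 0. *)
    have [nm|mn] := leqP n m; first by rewrite natrM natrB // mulrC.
    by rewrite bin_small // muln0 mul0r.
  by move: n.+1%:R an0 n0 => z az0 z0; field; rewrite g0 z0 az0.
have -> : connector a m.+1 n.+1 =
    'C(m, n)%:R * m.+1%:R / gbinom (a - 1) n / (a - n.+1%:R).
  rewrite /connector gbinomS.
  have -> : 'C(m.+1, n.+1)%:R = 'C(m, n)%:R * m.+1%:R / n.+1%:R :> F.
    by apply: (canRL (mulfK n0)); rewrite -!natrM mulnC -mul_bin_diag mulnC.
  by move: n.+1%:R an0 n0 => z az0 z0; field; rewrite g0 z0 az0.
rewrite /connector; move: an0 am0 n0 m0; rewrite -!natr1 => an0 am0 n0 m0.
by field; rewrite g0 an0 m0 am0.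
Qed.

(** * Nested sums, by recursion from the largest variable down *)

(* [rowsum h k m] is the sum of h b_1 / (b_2 ... b_(k+1)) over
   0 < b_1 <= ... <= b_(k+1) < m: there are k + 1 variables, not k. *)
Fixpoint rowsum (F : fieldType) (h : nat -> F) (k m : nat) : F :=
  if k is k'.+1 then \sum_(1 <= b < m) rowsum h k' b.+1 / b%:R
  else \sum_(1 <= b < m) h b.

Fixpoint leftsum (F : fieldType) (f : nat -> nat -> F) (r m : nat) : F :=
  if r is r'.+1 then \sum_(1 <= n < m) leftsum f r' n * f r' n else 1.

(** The innermost variable [b] of the last row is its first entry: it carries the shifted weight and
    strictly bounds all earlier rows. The predecessor compensates for the extra variable of
    [rowsum]. *)
Fixpoint rightsum (F : fieldType) (a : nat -> F) (k : nat -> nat) (r m : nat) : F :=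
  if r is r'.+1 then
    rowsum (fun b => rightsum a k r' b / (b%:R - a r')) (k r').-1 m
  else 1.

Lemma eq_rowsum (F : fieldType) (h h' : nat -> F) k m :
  (forall b, (0 < b < m)%N -> h b = h' b) -> rowsum h k m = rowsum h' k m.
Proof.
elim: k m => [|k IHk] m hh' /=; apply: eq_big_nat => b /andP[b0 bm].
  by apply: hh'; rewrite b0.
congr (_ / _); apply: IHk => c /andP[c0 cb].
by apply: hh'; rewrite c0 (leq_trans cb).
Qed.

Lemma rowsumZ (F : fieldType) (c : F) (h : nat -> F) k m :
  rowsum (fun b => c * h b) k m = c * rowsum h k m.
Proof.
elim: k m => [|k IHk] m /=; first by rewrite mulr_sumr.
by rewrite mulr_sumr; apply: eq_bigr => b _; rewrite IHk mulrA.
Qed.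

(** * Transport of the connector through the nested sums *)

Lemma rowsum_connector (F : fieldType) (a : F) (G : nat -> F) N k m :
  [pchar F] =i pred0 ->
  \sum_(1 <= n < N) G n / n%:R ^+ k.+1 * connector a m n =
  rowsum (fun b => (\sum_(1 <= n < N) G n * connector a b n) / b%:R) k m.+1.
Proof.
(* One factor 1 / n is traded at a time: [connectorBl] telescopes in [M], starting from D_a(0, n) =
   0 for n > 0. *)
move=> F0; have rec j M : \sum_(1 <= n < N) G n / n%:R ^+ j.+1 * connector a M n =
  \sum_(1 <= b < M.+1) (\sum_(1 <= n < N) G n / n%:R ^+ j * connector a b n) / b%:R.
  elim: M => [|M IHM].
    rewrite [RHS]big_geq //; apply: big1_seq => n /=; rewrite mem_index_iota.
    by case: n => // n _; rewrite /connector bin0n mul0r mulr0.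
  rewrite big_nat_recr //= -IHM; apply/eqP; rewrite -subr_eq0 opprD addrA subr_eq0.
  rewrite -sumrB mulr_suml; apply/eqP; apply: eq_big_nat => n /andP[n0 _].
  by rewrite -mulrBr -[RHS]mulrA -connectorBl // exprS invfM; ring.
elim: k m => [|k IHk] m; rewrite rec.
  by apply: eq_bigr => b _; congr (_ / _); apply: eq_bigr => n _; rewrite expr0 divr1.
by apply: eq_bigr => b _; rewrite IHk.
Qed.

(** By [connectorBr] the sum telescopes; its upper end D_a(m, N - 1) vanishes because m < N - 1. *)
Lemma sum_connector (F : fieldType) (a : F) N m s : [pchar F] =i pred0 ->
  (m.+1 < N)%N -> (s < N)%N -> (forall c, (0 < c < N)%N -> a != c%:R) ->
  (\sum_(s.+1 <= n < N) connector a m.+1 n) / m.+1%:R =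
  connector a m s / (a - m.+1%:R).
Proof.
move=> F0 mN sN aN; have am : a != m.+1%:R by rewrite aN.
rewrite mulr_suml.
rewrite (telescope_sumr_eq (fun n => - (connector a m n.-1 / (a - m.+1%:R)))) //=.
  have mN1 : (m < N.-1)%N by case: N mN {sN aN}.
  by rewrite {1}/connector bin_small // !mul0r oppr0 add0r opprK.
case=> // n /andP[_ nN]; rewrite -connectorBr //= => [|c /andP[c0 cn]].
  by rewrite opprK mulrBl addrC.
by rewrite aN // c0 (leq_ltn_trans cn).
Qed.

Lemma exchange_sum_lt (V : nmodType) (E : nat -> nat -> V) N :
  \sum_(1 <= n < N) \sum_(1 <= s < n) E s n =
  \sum_(1 <= s < N) \sum_(s.+1 <= n < N) E s n.
Proof.
transitivity (\sum_(1 <= n < N) \sum_(1 <= s < N | (s < n)%N) E s n).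
  by apply: eq_big_nat => n /andP[_ nN]; rewrite (big_nat_widen _ _ _ _ _ (ltnW nN)).
rewrite (exchange_big_dep_nat xpredT) //=; apply: eq_bigr => s _.
by rewrite (@big_nat_widenl _ _ _ s.+1 1).
Qed.

(* The [if] makes the case r = 0 the start of the induction: the peeled sum for
   r = 0 has no connector left. *)
Lemma sum_leftsum_connector (F : fieldType) (a : nat -> F) (k : nat -> nat) N r m
    (f := fun i n => (n%:R ^+ k i)^-1 * (gbinom (a i.+1 - 1) n / gbinom (a i - 1) n)) :
  [pchar F] =i pred0 -> (forall i, (i < r)%N -> (0 < k i)%N) ->
  (forall i c, (i < r)%N -> (0 < c < N)%N -> a i != c%:R) -> (m < N)%N ->
  (if r is r'.+1 then
     \sum_(1 <= n < N) leftsum f r' n / n%:R ^+ k r' * connector (a r') m n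
   else 1) = (-1) ^+ r * rightsum a k r m.+1.
Proof.
move=> F0; elim: r m => [|r IHr] m k0 aN mN; first by rewrite mulr1.
have aNr c : (0 < c < N)%N -> a r != c%:R by apply: aN.
rewrite /= -[k r in LHS]prednK ?k0 // rowsum_connector // exprS -mulrA -!rowsumZ.
apply: eq_rowsum => -[|b] //= bm; have bN := leq_trans bm mN.
rewrite mulN1r mulrA -IHr //; last 3 first.
- by move=> i ir; rewrite k0 // ltnW.
- by move=> i c ir; apply: aN; rewrite ltnW.
- exact: ltnW.
(* Passing from 1 / (b - a) to 1 / (a - b) absorbs one sign per row, which is the source of
   [(-1) ^+ r]. *)
rewrite -opprB invrN mulrN opprK.
case: r {IHr k0 aN} aNr => [|r] aNr.
  (* For the first row the telescoping stops at s = 0, where the connector is 1. *)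
  have N0 : (0 < N)%N by apply: leq_trans mN.
  under eq_bigr do rewrite mul1r.
  by rewrite sum_connector // /connector bin0 gbinom0 divr1.
under eq_bigr do rewrite /= mulr_suml.
(* With [s] = n_(r-1) fixed outside, the inner sum over n > s is the one that telescopes to a
   connector at [s]. *)
rewrite exchange_sum_lt !mulr_suml; apply: eq_big_nat => s /andP[_ sN].
rewrite -mulr_sumr -mulrA sum_connector // mulrA; congr (_ / _).
(* This binomial is both the denominator of the new connector and the numerator in [f r s];
   cancelling it turns the connector for [a r.+1] into the one for [a r]. *)
have: gbinom (a r.+1 - 1) s != 0.
  by apply: gbinom_neq0 => // c /andP[c0 cs]; rewrite aNr // c0 (leq_ltn_trans cs).
rewrite /f /connector; move: (gbinom _ s) (gbinom _ s)^-1 (_ ^- _) => g h x g0.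
by field.
Qed.

(** Since [a r] is N, the numerator of the last factor is the ordinary C(N - 1, n), so that factor
    already contains the connector with m = N - 1. *)
Lemma leftsum_rightsum (F : fieldType) (a : nat -> F) (k : nat -> nat) N r
    (f := fun i n => (n%:R ^+ k i)^-1 * (gbinom (a i.+1 - 1) n / gbinom (a i - 1) n)) :
  [pchar F] =i pred0 -> (forall i, (i < r)%N -> (0 < k i)%N) ->
  (forall i c, (i < r)%N -> (0 < c < N)%N -> a i != c%:R) -> (0 < N)%N ->
  a r = N%:R -> leftsum f r N = (-1) ^+ r * rightsum a k r N.
Proof.
case: N => // N F0 k0 aN _ ar; rewrite -(sum_leftsum_connector F0 k0 aN (ltnSn N)).
case: r ar {k0 aN} => //= r ar; apply: eq_big_nat => n /andP[_ nN].
by rewrite {2}/f ar -natr1 addrK gbinom_nat // mulrA.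
Qed.

(** * Sums over finite functions as nested sums: strict chains *)

Lemma ord_recrP r (P : 'I_r.+1 -> Prop) :
  P ord_max -> (forall i : 'I_r, P (widen_ord (leqnSn r) i)) -> forall i, P i.
Proof.
move=> Pmax Pw i; have [j ->|->] // := unliftP ord_max i.
by have -> : lift ord_max j = widen_ord (leqnSn r) j by apply: val_inj; exact: lift_max.
Qed.

(** Splitting off the last value is injective between sets of equal cardinality, hence a
    bijection. *)
Lemma sum_ffun_recr (V : nmodType) (T : finType) r (E : {ffun 'I_r -> T} -> T -> V) :
  \sum_(n : {ffun 'I_r.+1 -> T})
     E [ffun i => n (widen_ord (leqnSn r) i)] (n ord_max) =
  \sum_n \sum_t E n t.
Proof.
pose h (n : {ffun 'I_r.+1 -> T}) :=
  ([ffun i => n (widen_ord (leqnSn r) i)] : {ffun 'I_r -> T}, n ord_max).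
have h_bij : bijective h.
  apply: inj_card_bij => [n n' [/ffunP nn' n_max]|].
    apply/ffunP; apply: ord_recrP => // i.
    by have := nn' i; rewrite !ffunE.
  by rewrite card_prod !card_ffun !card_ord expnSr.
by rewrite pair_big [RHS](reindex h) //; apply: onW_bij.
Qed.

(** Dependent counterpart, for rows whose lengths, and so types, vary. *)
Lemma sum_dffun_recr (V : nmodType) r (T : 'I_r.+1 -> finType)
    (Tw := fun i : 'I_r => T (widen_ord (leqnSn r) i))
    (E : {dffun forall i : 'I_r, Tw i} -> T ord_max -> V) :
  \sum_(n : {dffun forall i : 'I_r.+1, T i})
     E (finfun (fun i : 'I_r => n (widen_ord (leqnSn r) i) : Tw i)) (n ord_max) =
  \sum_n \sum_t E n t.
Proof.
pose h (n : {dffun forall i : 'I_r.+1, T i}) :=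
  (finfun (fun i : 'I_r => n (widen_ord (leqnSn r) i) : Tw i)
     : {dffun forall i : 'I_r, Tw i}, n ord_max).
have h_bij : bijective h.
  apply: inj_card_bij => [n n' [/ffunP nn' n_max]|].
    apply/ffunP; apply: ord_recrP => // i.
    by have := nn' i; rewrite !ffunE.
  rewrite card_prod !card_dep_ffun /image_mem !foldrE !big_image /=.
  by rewrite big_ord_recr.
by rewrite pair_big [RHS](reindex h) //; apply: onW_bij.
Qed.

Lemma sum_ord_lt (V : nmodType) (E : nat -> V) N m : (m <= N)%N ->
  \sum_(t < N) (if (0 < t < m)%N then E t else 0) = \sum_(1 <= t < m) E t.
Proof.
move=> mN; rewrite -big_mkcond (big_nat_widen _ _ _ _ _ mN).
by rewrite (@big_nat_widenl _ _ _ 1 0) // big_mkord; apply: eq_bigl => t; rewrite andbC.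
Qed.

(** The bound [m] is separate from [N] so that induction applies: fixing the last value [t] leaves a
    chain below [t] in the same type ['I_N]. *)
Lemma big_leftsum (F : fieldType) (f : nat -> nat -> F) N r m : (m <= N)%N ->
  \sum_(n : {ffun 'I_r -> 'I_N} | lhs_range n && [forall i, (n i < m)%N])
     \prod_(i < r) f i (n i) = leftsum f r m.
Proof.
elim: r m => [|r IHr] m mN.
  rewrite (big_pred1 (ffun0 (card_ord 0))) ?big_ord0 // => n /=.
  have -> : n == ffun0 (card_ord 0) by apply/eqP/ffunP => -[].
  by rewrite /lhs_range; apply/andP; split; [apply/andP; split|]; apply/forallP => -[].
have mN1 t : (0 < t < m)%N -> (t <= N)%N.
  by case/andP => _ tm; rewrite (leq_trans (ltnW tm)).
(* Conditions are stored as nested tests, so that the sum becomes an unrestricted double sum whose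
   order can be exchanged. *)
pose E (n : {ffun 'I_r -> 'I_N}) (t : 'I_N) :=
  if (0 < t < m)%N then
    if lhs_range n && [forall i, (n i < t)%N] then
      (\prod_(i < r) f i (n i)) * f r t else 0
  else 0.
rewrite [RHS]/= -(sum_ord_lt _ mN).
transitivity (\sum_n \sum_t E n t); last first.
  rewrite exchange_big; apply: eq_bigr => t _; rewrite /E.
  case: ifP => [tm|_]; last by rewrite big1.
  by rewrite -big_mkcond -mulr_suml IHr ?mN1.
rewrite -sum_ffun_recr big_mkcond; apply: eq_bigr => n _; rewrite /E -if_and.
rewrite big_ord_recr /=.
under [in RHS]eq_bigr do rewrite ffunE.
congr (if _ then _ else _).
apply/andP/andP.
  move=> [/andP[/forallP n0 /forallP nlt] /forallP nm].
  split; first by rewrite n0 nm.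
  apply/andP; split; last first.
    by apply/forallP => i; rewrite ffunE (implyP (forallP (nlt _) ord_max)) //= ltn_ord.
  apply/andP; split; apply/forallP => i; rewrite ?ffunE ?n0 //.
  apply/forallP => j; rewrite !ffunE; apply/implyP => ij.
  exact: (implyP (forallP (nlt _) _)).
move=> [/andP[n0 nm] /andP[/andP[/forallP w0 /forallP wlt] /forallP wm]].
split; last first.
  apply/forallP; apply: ord_recrP => // i.
  by have := wm i; rewrite ffunE => /ltn_trans; apply.
apply/andP; split; apply/forallP; apply: ord_recrP => //.
- by move=> i; have := w0 i; rewrite ffunE.
- by apply/forallP => j; rewrite /= ltnNge -ltnS ltn_ord.
move=> i; apply/forallP; apply: ord_recrP => [|j].
  by have := wm i; rewrite ffunE => ->; rewrite implybT.
by have := forallP (wlt i) j; rewrite !ffunE.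
Qed.

(** * Weakly increasing rows and families of rows *)

Definition row_range N k (n : {ffun 'I_k -> 'I_N}) : bool :=
  [forall l : 'I_k, (0 < n l)%N] &&
  [forall l : 'I_k, forall m : 'I_k, (l <= m)%N ==> (n l <= n m)%N].

(** The order is weak, so the remaining entries are bounded by the last entry plus one; this matches
    [b.+1] in [rowsum]. *)
Lemma row_range_recr N k m (n : {ffun 'I_k.+1 -> 'I_N})
    (w := [ffun l => n (widen_ord (leqnSn k) l)] : {ffun 'I_k -> 'I_N}) :
  row_range n && [forall l, (n l < m)%N] =
  (0 < n ord_max < m)%N && (row_range w && [forall l, (w l < (n ord_max).+1)%N]).
Proof.
apply/andP/andP.
  move=> [/andP[/forallP n0 /forallP nle] /forallP nm].
  split; first by rewrite n0 nm.
  apply/andP; split; last first.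
    apply/forallP => i.
    by rewrite ffunE ltnS (implyP (forallP (nle _) ord_max)) //= ltnW.
  apply/andP; split; apply/forallP => i; rewrite ?ffunE ?n0 //.
  apply/forallP => j; rewrite !ffunE; apply/implyP => ij.
  exact: (implyP (forallP (nle _) _)).
move=> [/andP[n0 nm] /andP[/andP[/forallP w0 /forallP wle] /forallP wm]].
split; last first.
  apply/forallP; apply: ord_recrP => // i.
  by have := wm i; rewrite ffunE ltnS => /leq_ltn_trans; apply.
apply/andP; split; apply/forallP; apply: ord_recrP => //.
- by move=> i; have := w0 i; rewrite ffunE.
- apply/forallP; apply: ord_recrP => [|j]; first by rewrite !leqnn.
  by rewrite /= leqNgt ltn_ord.
move=> i; apply/forallP; apply: ord_recrP => [|j].
  by have := wm i; rewrite ffunE ltnS => ->; rewrite implybT.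
by have := forallP (wle i) j; rewrite !ffunE.
Qed.

Lemma big_rowsumS (F : fieldType) (h : nat -> F) N k m : (m <= N)%N ->
  \sum_(n : {ffun 'I_k.+1 -> 'I_N} | row_range n && [forall l, (n l < m)%N])
     h (n ord0) / \prod_(l < k) (n (lift ord0 l))%:R = rowsum h k m.
Proof.
elim: k m => [|k IHk] m mN; rewrite [RHS]/= -(sum_ord_lt _ mN).
  (* Only one function has empty domain, so the sum over [w] has a single term. *)
  pose E (w : {ffun 'I_0 -> 'I_N}) (t : 'I_N) := if (0 < t < m)%N then h t else 0.
  transitivity (\sum_w \sum_t E w t); last first.
    by rewrite exchange_big; apply: eq_bigr => t _; rewrite /E /= sumr_const card_ffun !card_ord.
  rewrite -sum_ffun_recr big_mkcond; apply: eq_bigr => n _.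
  rewrite row_range_recr /E big_ord0 divr1.
  have -> : ord_max = ord0 :> 'I_1 by apply: val_inj.
  congr (if _ then _ else _); rewrite [X in _ && X](_ : _ = true) ?andbT //.
  by apply/andP; split; [apply/andP; split|]; apply/forallP => -[].
pose E (w : {ffun 'I_k.+1 -> 'I_N}) (t : 'I_N) :=
  if (0 < t < m)%N then
    if row_range w && [forall l, (w l < t.+1)%N] then
      h (w ord0) / \prod_(l < k) (w (lift ord0 l))%:R / t%:R else 0
  else 0.
transitivity (\sum_w \sum_t E w t); last first.
  rewrite exchange_big; apply: eq_bigr => t _; rewrite /E.
  case: ifP => [tm|_]; last by rewrite big1.
  rewrite -big_mkcond -mulr_suml IHk //.
rewrite -sum_ffun_recr big_mkcond; apply: eq_bigr => n _.
rewrite row_range_recr /E -if_and; congr (if _ then _ else _).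
rewrite big_ord_recr /= invfM mulrA ffunE.
have -> : widen_ord (leqnSn k.+1) ord0 = ord0 by apply: val_inj.
have -> : lift ord0 ord_max = ord_max :> 'I_k.+2 by apply: val_inj.
congr (_ / _ / _); apply: eq_bigr => l _; rewrite ffunE.
by congr (n _)%:R; apply: val_inj.
Qed.

Lemma big_rowsum (F : fieldType) (h : nat -> F) a N k m (k0 : (0 < k)%N) : (m <= N)%N ->
  \sum_(n : {ffun 'I_k -> 'I_N} | row_range n && [forall l, (n l < m)%N])
     h (n (Ordinal k0)) /
     \prod_(l < k) (if l == 0%N :> nat then (n l)%:R - a else (n l)%:R) =
  rowsum (fun b => h b / (b%:R - a)) k.-1 m.
Proof.
case: k k0 => // k k0 mN; rewrite -(big_rowsumS _ _ mN); apply: eq_bigr => n _.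
have -> : Ordinal k0 = ord0 by apply: val_inj.
by rewrite big_ord_recl invfM mulrA.
Qed.

(** The bound [m] is put on the last entry of the last row only, the shape of the clause linking
    adjacent rows. Once the last row is removed, that clause becomes the bound on the row before it,
    with the first entry of the removed row in place of [m]. *)
Lemma rhs_range_recr N r (k : 'I_r.+1 -> nat) (k0 : forall i, (0 < k i)%N) m
    (kw := fun i : 'I_r => k (widen_ord (leqnSn r) i)) (n : family2 N k)
    (w := finfun (fun i : 'I_r => n (widen_ord (leqnSn r) i)
                    : {ffun 'I_(kw i) -> 'I_N}) : family2 N kw) :
  rhs_range n && [forall i : 'I_r.+1, forall l : 'I_(k i),
     (i.+1 == r.+1) && (l == (k i).-1 :> nat) ==> (n i l < m)%N] =
  (row_range (n ord_max) && [forall l, (n ord_max l < m)%N]) &&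
  (rhs_range w && [forall i : 'I_r, forall l : 'I_(kw i),
     (i.+1 == r) && (l == (kw i).-1 :> nat) ==>
     (w i l < n ord_max (Ordinal (k0 ord_max)))%N]).
Proof.
apply/andP/andP.
  move=> [/and3P[/forallP n0 /forallP nle /forallP nlt] /forallP nm].
  split.
    apply/andP; split; first by rewrite /row_range n0 nle.
    (* Monotonicity spreads the bound from the last entry to the whole row. *)
    have km : ((k ord_max).-1 < k ord_max)%N by rewrite prednK.
    apply/forallP => l.
    have := forallP (nm ord_max) (Ordinal km); rewrite !eqxx /=.
    apply: leq_ltn_trans; have /forallP/(_ l)/forallP/(_ (Ordinal km)) := nle ord_max.
    by rewrite /= -ltnS prednK // ltn_ord.
  apply/andP; split.
    apply/and3P; split; apply/forallP => i.
    - by rewrite ffunE; apply: n0.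
    - by rewrite ffunE; apply: nle.
    apply/forallP => j; rewrite !ffunE.
    exact: (forallP (nlt (widen_ord (leqnSn r) i)) (widen_ord (leqnSn r) j)).
  apply/forallP => i; apply/forallP => l; apply/implyP => /andP[ir lk].
  have /forallP/(_ ord_max)/forallP/(_ l)/forallP/(_ (Ordinal (k0 ord_max))) :=
    nlt (widen_ord (leqnSn r) i).
  by rewrite ffunE /= eq_sym ir lk.
move=> [/andP[/andP[nmax0 nmaxle] /forallP nmaxm]].
move=> [/andP[/and3P[/forallP w0 /forallP wle /forallP wlt] /forallP wm]].
split; last first.
  apply/forallP; apply: ord_recrP => [|i].
    by apply/forallP => l; rewrite nmaxm implybT.
  by apply/forallP => l; rewrite /= eqSS ltn_eqF ?ltn_ord.
apply/and3P; split; apply/forallP; apply: ord_recrP => //.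
- by move=> i; have := w0 i; rewrite ffunE.
- by move=> i; have := wle i; rewrite ffunE.
(* No row follows the last one, so the premise is false. *)
- apply/forallP => j; apply/forallP => l; apply/forallP => p.
  by rewrite /= ltn_eqF ?ltn_ord.
move=> i; apply/forallP; apply: ord_recrP => [|j]; last first.
  by have := forallP (wlt i) j; rewrite !ffunE.
apply/forallP => l; apply/forallP => p; apply/implyP => /and3P[ir lk /eqP p0].
have := forallP (wm i) l; rewrite ffunE eq_sym ir lk /=.
by have -> : Ordinal (k0 ord_max) = p by apply: val_inj.
Qed.

(** [K] gives the row lengths on all naturals, so it stays fixed in the induction while the domain
    of [k] shrinks. *)
Lemma big_rightsum (F : fieldType) (a : nat -> F) (K : nat -> nat) N r
    (k : 'I_r -> nat) m :
  (forall i, k i = K i) -> (forall i, (0 < k i)%N) -> (m <= N)%N ->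
  \sum_(n : family2 N k | rhs_range n && [forall i : 'I_r, forall l : 'I_(k i),
         (i.+1 == r) && (l == (k i).-1 :> nat) ==> (n i l < m)%N])
     \prod_(j < r) (\prod_(l < k j)
        (if l == 0%N :> nat then (n j l)%:R - a j else (n j l)%:R))^-1
  = rightsum a K r m.
Proof.
elim: r k m => [|r IHr] k m kK k0 mN.
  rewrite (big_pred1 (ffun0 (card_ord 0) : family2 N k)) ?big_ord0 // => n /=.
  have -> : n == ffun0 (card_ord 0) by apply/eqP/ffunP => -[].
  by rewrite /rhs_range; apply/andP; split; [apply/and3P; split|]; apply/forallP => -[].
pose kw i := k (widen_ord (leqnSn r) i).
pose den k' j (t : {ffun 'I_k' -> 'I_N}) : F :=
  \prod_(l < k') (if l == 0%N :> nat then (t l)%:R - a j else (t l)%:R).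
pose E (w : family2 N kw) (t : {ffun 'I_(k ord_max) -> 'I_N}) :=
  if row_range t && [forall l, (t l < m)%N] then
    if rhs_range w && [forall i : 'I_r, forall l : 'I_(kw i),
     (i.+1 == r) && (l == (kw i).-1 :> nat) ==>
     (w i l < t (Ordinal (k0 ord_max)))%N]
    then (\prod_(j < r) (den (kw j) j (w j))^-1) / den (k ord_max) r t else 0
  else 0.
transitivity (\sum_w \sum_t E w t); last first.
  have Kr : K r = k ord_max by rewrite kK.
  rewrite exchange_big [RHS]/= Kr -(big_rowsum _ _ (k0 ord_max) mN) [RHS]big_mkcond.
  apply: eq_bigr => t _; rewrite /E; case: ifP => [tm|_]; last by rewrite big1.
  rewrite -big_mkcond -mulr_suml IHr //; [by move=> i; rewrite /kw kK | by move=> i; exact: k0 | exact: ltnW].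
apply: etrans (sum_dffun_recr (T := fun i => {ffun 'I_(k i) -> 'I_N} : finType) E).
rewrite big_mkcond.
apply: eq_bigr => n _; rewrite (rhs_range_recr k0) /E -if_and.
congr (if _ then _ else _); rewrite big_ord_recr /=; congr (_ / _).
by apply: eq_bigr => j _; rewrite ffunE.
Qed.

(** * Specialization to rational functions *)

Lemma pchar_ratfun r : [pchar ratfun r] =i pred0.
Proof.
apply/pcharf0P => n.
rewrite -(rmorph_nat (@tofrac {mpoly rat[r]})) tofrac_eq0 -mpolyC_nat mpolyC_eq0.
exact: Num.Theory.pnatr_eq0.
Qed.

(** The coefficients of the variable [i] on the two sides are N and 0. *)
Lemma xvar_neq_nat r N (i : 'I_r) c : (0 < N)%N -> N%:R * xvar r i != c%:R.
Proof.
move=> N0; rewrite /xvar valK -!(rmorph_nat (@tofrac {mpoly rat[r]})) -rmorphM tofrac_eq.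
apply/eqP => /(congr1 (mcoeff U_(i))).
rewrite mulr_natl mcoeffMn mcoeffX eqxx -mpolyC_nat mcoeffC mnm1_eq0 mulr0 => /eqP.
by rewrite Num.Theory.pnatr_eq0 eqn0Ngt N0.
Qed.

Lemma xvar_last r : xvar r r = 1.
Proof. by rewrite /xvar insubF ?ltnn. Qed.

Theorem theorem1p2 (r : nat) (k : 'I_r -> nat) (hk : forall i, (0 < k i)%N)
    (N : nat) (hN : (0 < N)%N) :
  \sum_(n : {ffun 'I_r -> 'I_N} | lhs_range n)
     (\prod_(i < r) (n i)%:R ^+ k i)^-1 *
     \prod_(i < r) (gbinom (N%:R * xvar r i.+1 - 1) (n i) /
                    gbinom (N%:R * xvar r i - 1) (n i))
  = (-1) ^+ r *
  \sum_(n : family2 N k | rhs_range n)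
     \prod_(j < r)
        (\prod_(l < k j)
           (if l == 0%N :> nat then (n j l)%:R - N%:R * xvar r j
            else (n j l)%:R))^-1.
Proof.
(* The default 0 of [K] occurs only for [i >= r], outside the rows. *)
pose a i := N%:R * xvar r i; pose K i := if insub i is Some j then k j else 0%N.
have kK i : k i = K i by rewrite /K valK.
have F0 := @pchar_ratfun r.
pose f i n : ratfun r := (n%:R ^+ K i)^-1 * (gbinom (a i.+1 - 1) n / gbinom (a i - 1) n).
transitivity (leftsum f r N).
  rewrite -(big_leftsum f r (leqnn N)); apply: eq_big => n.
    by rewrite [X in _ && X](_ : _ = true) ?andbT //; apply/forallP.
  by rewrite -prodfV -big_split => _; apply: eq_bigr => i _; rewrite /f -kK.
transitivity ((-1) ^+ r * rightsum a K r N); last first.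
  congr (_ * _); rewrite -(big_rightsum a kK hk (leqnn N)); apply: eq_bigl => n.
  rewrite [X in _ && X](_ : _ = true) ?andbT //.
  by do 2!apply/forallP => ?; rewrite ltn_ord implybT.
have K0 i : (i < r)%N -> (0 < K i)%N by move=> ir; have := hk (Ordinal ir); rewrite kK.
have aN i c : (i < r)%N -> (0 < c < N)%N -> a i != c%:R.
  by move=> ir _; apply: (xvar_neq_nat (Ordinal ir)).
(* The convention x_(r+1) = 1 is what gives [a r] the value N. *)
by apply: leftsum_rightsum; rewrite // /a xvar_last mulr1.
Qed.
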